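(* Let $\mathcal{H}$ be a real Hilbert space, let $\varphi\in\Gamma_0(\mathbb{R})$ be an even supercoercive function such that $\operatorname{dom}\varphi=\mathbb{R}$, set $f=\varphi\circ\|\cdot\|\colon\mathcal{H}\to\,]-\infty,+\infty]$, and let $(x,\eta,\delta)\in\mathcal{H}\times\mathbb{R}\times\mathbb{R}$. Then $$P_{\operatorname{epi}\widetilde{f}}(x,\eta,\delta)=\begin{cases}(x,\max\{\eta,0\},\delta),&\text{if }\widetilde{\varphi}(\|x\|,\max\{\eta,0\})\le\delta;\\[1mm](0,0,0),&\text{if }\widetilde{\varphi}(\|x\|,\max\{\eta,0\})>\delta,\ \delta<0,\ \text{and }\eta-\delta\varphi^*\!\left(\frac{\|x\|}{-\delta}\right)\le0;\\[1mm]\left(0,\frac{\eta-\delta\varphi^*(0)}{1+(\varphi^*(0))^2},\frac{\varphi^*(0)(\delta\varphi^*(0)-\eta)}{1+(\varphi^*(0))^2}\right),&\text{if }\widetilde{\varphi}(\|x\|,\max\{\eta,0\})>\delta,\ \eta-\delta\varphi^*(0)>0,\ \text{and }x=0;\\[2mm]\left(\operatorname{prox}_{\frac{\mu}{\nu}\varphi}\!\left(\frac{\|x\|}{\nu}\right)\frac{\nu x}{\|x\|},\nu,\delta+\mu\right),&\text{otherwise},\end{cases}$$ where, in the last case, $\nu>0$ and $\mu>0$ are the unique solutions to the $2\times2$ system of nonlinear equations $$\mu+\delta=\nu\,\varphi\!\left(\operatorname{prox}_{\frac{\mu}{\nu}\varphi}\!\left(\frac{\|x\|}{\nu}\right)\right),\qquad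 \nu-\eta=\mu\,\varphi^*\!\left(\operatorname{prox}_{\frac{\nu}{\mu}\varphi^*}\!\left(\frac{\|x\|}{\mu}\right)\right).$$
   Context: $\Gamma_0(\mathcal{H})$ is the class of proper lower semicontinuous convex functions from the real Hilbert space $\mathcal{H}$ to $]-\infty,+\infty]$; $\operatorname{dom} f=\{x\in\mathcal{H} : f(x)<+\infty\}$. A function $\varphi$ is supercoercive if $\varphi(\xi)/|\xi|\to+\infty$ as $|\xi|\to+\infty$. The conjugate of $g\in\Gamma_0(\mathcal{H})$ is $g^*(u)=\sup_{x\in\mathcal{H}}(\langle x,u\rangle-g(x))$. The recession function of $g\in\Gamma_0(\mathcal{H})$ is $(\operatorname{rec} g)(x)=\lim_{t\to+\infty}\frac{g(x_0+tx)-g(x_0)}{t}$, for any $x_0\in\operatorname{dom} g$ (the value does not depend on $x_0$). The perspective of $g$ is $\widetilde{g}\colon\mathcal{H}\times\mathbb{R}\to\,]-\infty,+\infty]$, defined by $\widetilde{g}(x,\eta)=\eta g(x/\eta)$ if $\eta>0$, $\widetilde{g}(x,0)=(\operatorname{rec} g)(x)$, and $\widetilde{g}(x,\eta)=+\infty$ if $\eta<0$; this applies both to $f$ (on $\mathcal{H}$) and to $\varphi$ (on $\mathbb{R}$). The epigraph is $\operatorname{epi}\widetilde{f}=\{(x,\eta,\delta)\in\mathcal{H}\times\mathbb{R}\times\mathbb{R} : \widetilde{f}(x,\eta)\le\delta\}$, a closed convex cone in the Hilbert direct sum $\mathcal{H}\oplus\mathbb{R}\oplus\mathbb{R}$. For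 $g\in\Gamma_0(\mathcal{G})$ on a real Hilbert space $\mathcal{G}$, $\operatorname{prox}_g(z)$ is the unique minimizer of $y\mapsto g(y)+\frac12\|z-y\|^2$; $P_C$ denotes the projection onto a nonempty closed convex set $C$. *)

(* Defs.v *)
From HB Require Import structures.
From mathcomp Require Import all_boot all_order all_algebra.
From mathcomp Require Import all_classical all_reals all_analysis.
From mathcomp Require Import ring.
Set Implicit Arguments.
Unset Strict Implicit.
Unset Printing Implicit Defensive.
Import Order.TTheory GRing.Theory Num.Theory.
Import numFieldNormedType.Exports.
Local Open Scope classical_set_scope.
Local Open Scope ring_scope.

HB.mixin Record CompleteNormedModule_isHilbert (R : realType) H
    & CompleteNormedModule R H := {
  inner : {dot H for (@idfun R)} ;
  innerxx : forall x : H, inner x x = `|x| ^+ 2 }.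

#[short(type="hilbertType")]
HB.structure Definition Hilbert (R : realType) :=
  {H of CompleteNormedModule R H & CompleteNormedModule_isHilbert R H}.

Section inner_theory.
Context (R : realType) (H : hilbertType R).
Implicit Types x y z : H.
Local Notation "<[ x , y ]>" := (@inner R H x y).

Lemma innerC x y : <[x, y]> = <[y, x]>.
Proof. by rewrite hermitian_subproof expr0 mul1r. Qed.

Lemma innerDr x y z : <[z, x + y]> = <[z, x]> + <[z, y]>.
Proof. exact: linearD. Qed.

Lemma innerDl x y z : <[x + y, z]> = <[x, z]> + <[y, z]>.
Proof. by rewrite ![<[_, z]>]innerC innerDr. Qed.

Lemma innerZr a x z : <[z, a *: x]> = a * <[z, x]>.
Proof. exact: linearZ. Qed.

Lemma innerZl a x z : <[a *: x, z]> = a * <[x, z]>.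
Proof. by rewrite ![<[_, z]>]innerC innerZr. Qed.

Lemma innerBr x y z : <[z, x - y]> = <[z, x]> - <[z, y]>.
Proof. exact: linearB. Qed.

Lemma innerBl x y z : <[x - y, z]> = <[x, z]> - <[y, z]>.
Proof. by rewrite ![<[_, z]>]innerC innerBr. Qed.
End inner_theory.

Section hilbert_real.
Context (R : realType).

Definition real_inner (x y : R^o) : R := x * y.

Let real_inner_zmodl (y : R^o) : zmod_morphism (real_inner ^~ y).
Proof. by move=> x z; rewrite /real_inner mulrBl. Qed.

Let real_inner_zmodr (x : R^o) : zmod_morphism (real_inner x).
Proof. by move=> y z; rewrite /real_inner mulrBr. Qed.

Let real_inner_scalel (y : R^o) : scalable_for *%R (real_inner ^~ y).
Proof. by move=> a x; rewrite /real_inner -mulrA. Qed.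

Let real_inner_scaler (x : R^o) :
  scalable_for (@idfun R \; *%R) (real_inner x).
Proof. by move=> a y; rewrite /real_inner mulrCA. Qed.

Let real_inner_herm (x y : R^o) :
  real_inner x y = (-1) ^+ false * idfun (real_inner y x).
Proof. by rewrite expr0 mul1r /= /real_inner mulrC. Qed.

Let real_inner_gt0 (x : R^o) : x != 0 -> 0 < real_inner x x.
Proof. by move=> x0; rewrite /real_inner -expr2 exprn_even_gt0. Qed.

HB.instance Definition _ := isBilinear.Build R R^o R^o R *%R
  (@idfun R \; *%R) real_inner
  real_inner_zmodl real_inner_zmodr real_inner_scalel real_inner_scaler.
HB.instance Definition _ := isHermitianSesquilinear.Build R R^o false
  (@idfun R) real_inner real_inner_herm.
HB.instance Definition _ := isDotProduct.Build R R^o real_inner real_inner_gt0.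

Let real_innerxx (x : R^o) : real_inner x x = `|x| ^+ 2.
Proof. by rewrite real_normK ?num_real// expr2. Qed.

HB.instance Definition _ :=
  CompleteNormedModule_isHilbert.Build R R^o real_innerxx.
End hilbert_real.

(* [U * V] carries the max norm in MathComp-Analysis; the Hilbert direct sum
   is an alias of [U * V], normed by [sqrt (`|u| ^+ 2 + `|v| ^+ 2)]. *)
Definition hsum (U V : Type) : Type := (U * V)%type.
Notation "U '\oplus' V" := (hsum U V)
  (at level 50, left associativity) : type_scope.

Section hilbert_sum.
Context (R : realType) (U V : hilbertType R).
Local Notation W := (U \oplus V)%type.

HB.instance Definition _ := GRing.Lmodule.copy W (U * V)%type.

Definition hsum_inner (x y : W) : R := inner x.1 y.1 + inner x.2 y.2.

Let hsum_inner_zmodl (y : W) : zmod_morphism (hsum_inner ^~ y).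
Proof. by move=> x z; rewrite /hsum_inner !innerBl opprD addrACA. Qed.

Let hsum_inner_zmodr (x : W) : zmod_morphism (hsum_inner x).
Proof. by move=> y z; rewrite /hsum_inner !innerBr opprD addrACA. Qed.

Let hsum_inner_scalel (y : W) : scalable_for *%R (hsum_inner ^~ y).
Proof. by move=> a x; rewrite /hsum_inner !innerZl mulrDr. Qed.

Let hsum_inner_scaler (x : W) :
  scalable_for (@idfun R \; *%R) (hsum_inner x).
Proof. by move=> a y; rewrite /hsum_inner !innerZr /= mulrDr. Qed.

Let hsum_inner_herm (x y : W) :
  hsum_inner x y = (-1) ^+ false * idfun (hsum_inner y x).
Proof.
by rewrite expr0 mul1r /= /hsum_inner innerC [inner x.2 _]innerC.
Qed.

Let hsum_inner_gt0 (x : W) : x != 0 -> 0 < hsum_inner x x.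
Proof.
rewrite /hsum_inner !innerxx => x0.
rewrite lt0r addr_ge0 ?sqr_ge0// andbT.
apply: contra x0; rewrite paddr_eq0 ?sqr_ge0// !sqrf_eq0 !normr_eq0.
by case: x => x1 x2 /= /andP[/eqP-> /eqP->].
Qed.

HB.instance Definition _ := isBilinear.Build R W W R *%R
  (@idfun R \; *%R) hsum_inner
  hsum_inner_zmodl hsum_inner_zmodr hsum_inner_scalel hsum_inner_scaler.
HB.instance Definition _ := isHermitianSesquilinear.Build R W false
  (@idfun R) hsum_inner hsum_inner_herm.
HB.instance Definition _ := isDotProduct.Build R W hsum_inner hsum_inner_gt0.

Definition hsum_norm (x : W) : R := Num.sqrt (`|x.1| ^+ 2 + `|x.2| ^+ 2).

Let ler_hsum_normD (x y : W) : hsum_norm (x + y) <= hsum_norm x + hsum_norm y.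
Proof.
rewrite /hsum_norm.
set a := `|x.1|; set b := `|x.2|; set c := `|y.1|; set d := `|y.2|.
have a0 : 0 <= a by exact: normr_ge0.
have b0 : 0 <= b by exact: normr_ge0.
have c0 : 0 <= c by exact: normr_ge0.
have d0 : 0 <= d by exact: normr_ge0.
have n0 : 0 <= Num.sqrt (a ^+ 2 + b ^+ 2) + Num.sqrt (c ^+ 2 + d ^+ 2).
  by rewrite addr_ge0 ?sqrtr_ge0.
rewrite -[leRHS]ger0_norm// -sqrtr_sqr ler_sqrt ?sqr_ge0//.
apply: (@le_trans _ _ ((a + c) ^+ 2 + (b + d) ^+ 2)).
  by rewrite lerD// lerXn2r ?nnegrE ?addr_ge0// ler_normD.
rewrite [leRHS]sqrrD !sqr_sqrtr ?addr_ge0 ?sqr_ge0//.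
have CS : a * c + b * d <=
    Num.sqrt (a ^+ 2 + b ^+ 2) * Num.sqrt (c ^+ 2 + d ^+ 2).
  rewrite -sqrtrM ?addr_ge0 ?sqr_ge0// -[leLHS]ger0_norm ?addr_ge0 ?mulr_ge0//.
  rewrite -sqrtr_sqr ler_sqrt ?mulr_ge0 ?addr_ge0 ?sqr_ge0//.
  rewrite -subr_ge0 (_ : _ - _ = (a * d - b * c) ^+ 2) ?sqr_ge0//.
  by rewrite !expr2; ring.
rewrite [leLHS](_ : _ = a ^+ 2 + b ^+ 2 + (a * c + b * d) *+ 2
  + (c ^+ 2 + d ^+ 2)); first by rewrite lerD2r lerD2l lerMn2r CS.
by rewrite !expr2; ring.
Qed.

Let hsum_normZ (l : R) (x : W) : hsum_norm (l *: x) = `|l| * hsum_norm x.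
Proof.
rewrite /hsum_norm /= !normrZ !exprMn -mulrDr sqrtrM ?sqr_ge0//.
by rewrite sqrtr_sqr normr_id.
Qed.

Let hsum_norm0_eq0 (x : W) : hsum_norm x = 0 -> x = 0.
Proof.
move/eqP; rewrite sqrtr_eq0 -!innerxx => x0; apply: contraTeq x0 => x0.
by rewrite -ltNge hsum_inner_gt0.
Qed.

HB.instance Definition _ := @Lmodule_isNormed.Build R W
  hsum_norm ler_hsum_normD hsum_normZ hsum_norm0_eq0.

Lemma hsum_normE (x : W) : `|x| = Num.sqrt (`|x.1| ^+ 2 + `|x.2| ^+ 2).
Proof. by []. Qed.

Let hsum_norm1 (x : W) : `|x.1| <= `|x|.
Proof.
by rewrite hsum_normE -[leLHS]ger0_norm// -sqrtr_sqr ler_sqrt ?lerDl ?sqr_ge0//.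
Qed.

Let hsum_norm2 (x : W) : `|x.2| <= `|x|.
Proof.
by rewrite hsum_normE -[leLHS]ger0_norm// -sqrtr_sqr ler_sqrt ?lerDr ?sqr_ge0//.
Qed.

Let hsum_norm_le (x : W) : `|x| <= `|x.1| + `|x.2|.
Proof.
have n0 : 0 <= `|x.1| + `|x.2| by rewrite addr_ge0.
rewrite hsum_normE -[leRHS]ger0_norm// -sqrtr_sqr ler_sqrt ?sqr_ge0//.
by rewrite sqrrD lerD2r lerDl mulrn_wge0// mulr_ge0.
Qed.

Let hsum_complete (F : set_system W) :
  ProperFilter F -> cauchy F -> cvg F.
Proof.
move=> FF /cauchyP Fc.
have c1 : cvg ((fun x : W => x.1) @ F).
  apply: cauchy_cvg; apply/cauchyP => e e0.
  have [x Fx] := Fc _ e0; exists x.1; rewrite /= near_simpl.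
  apply: filterS Fx => y; rewrite -!ball_normE /=; apply: le_lt_trans.
  exact: (hsum_norm1 (x - y)).
have c2 : cvg ((fun x : W => x.2) @ F).
  apply: cauchy_cvg; apply/cauchyP => e e0.
  have [x Fx] := Fc _ e0; exists x.2; rewrite /= near_simpl.
  apply: filterS Fx => y; rewrite -!ball_normE /=; apply: le_lt_trans.
  exact: (hsum_norm2 (x - y)).
move: c1 c2 => /cvg_ex[l1 /cvgrPdist_lt l1P] /cvg_ex[l2 /cvgrPdist_lt l2P].
apply/cvg_ex; exists ((l1, l2) : W); apply/cvgrPdist_lt => e e0.
near=> x; apply: (le_lt_trans (hsum_norm_le _)).
rewrite [e]splitr ltrD//=.
  by near: x; apply: l1P; rewrite divr_gt0.
by near: x; apply: l2P; rewrite divr_gt0.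
Unshelve. all: by end_near. Qed.

HB.instance Definition _ := Uniform_isComplete.Build W hsum_complete.

Let hsum_innerxx (x : W) : hsum_inner x x = `|x| ^+ 2.
Proof.
by rewrite hsum_normE sqr_sqrtr ?addr_ge0 ?sqr_ge0// /hsum_inner !innerxx.
Qed.

HB.instance Definition _ :=
  CompleteNormedModule_isHilbert.Build R W hsum_innerxx.
End hilbert_sum.

Section convex_analysis.
Context (R : realType).
Local Open Scope ereal_scope.

Definition dom (T : Type) (g : T -> \bar R) : set T := [set x | g x < +oo].

Definition Gamma0 (G : hilbertType R) (g : G -> \bar R) : Prop :=
  [/\ (forall x, g x != -oo),
      (exists x, dom g x),
      lower_semicontinuous g &
      forall (x y : G) (t : R), (0 < t < 1)%R ->
        g (t *: x + (1 - t) *: y)%R <= t%:E * g x + (1 - t)%:E * g y].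

(* [|xi|] tends to [+oo] along both ends of the line. *)
Definition supercoercive (phi : R^o -> \bar R) : Prop :=
  (fun xi : R => phi xi * (`|xi|^-1)%:E) @ +oo%R --> +oo /\
  (fun xi : R => phi xi * (`|xi|^-1)%:E) @ -oo%R --> +oo.

Definition conjugate (G : hilbertType R) (g : G -> \bar R) (u : G) : \bar R :=
  ereal_sup [set (inner x u)%:E - g x | x in [set: G]].

(* The base point is an arbitrary point of the domain of [g]: for [g] in
   [Gamma0] the limit does not depend on it. *)
Definition recession (G : hilbertType R) (g : G -> \bar R) (x : G) : \bar R :=
  let x0 := xget 0%R (dom g) in
  lim ((fun t : R => (g (x0 + t *: x)%R - g x0) * (t^-1)%:E) @ +oo%R).

Definition perspective (G : hilbertType R) (g : G -> \bar R)
    (z : G \oplus R^o) : \bar R :=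
  let: (x, eta) := z in
  if (0 < eta)%R then eta%:E * g (eta^-1 *: x)%R
  else if eta == 0%R then recession g x else +oo.

Definition epi (G : hilbertType R) (g : G -> \bar R) : set (G \oplus R^o) :=
  [set z | g z.1 <= (z.2)%:E].

(* [metric_proj C z] and [prox g z] default to [0] when no minimizer exists. *)
Definition metric_proj (G : hilbertType R) (C : set G) (z : G) : G :=
  xget 0%R [set p | C p /\ forall y, C y -> (`|z - p| <= `|z - y|)%R].

Definition prox (G : hilbertType R) (g : G -> \bar R) (z : G) : G :=
  xget 0%R [set p | forall y,
    g p + (2^-1 * `|z - p| ^+ 2)%:E <= g y + (2^-1 * `|z - y| ^+ 2)%:E].

End convex_analysis.

(* Main.v *)
(* The epigraph of the perspective of [phi o |.|] is the set of the
   [(y, b, d)] with [b >= 0] and [u |y| - phi^*(u) b <= d] for all [u], so that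
   the problem is radial: [(|x|, eta, delta)] has to be projected onto a closed
   convex cone of R^3. In the first three cases the announced point satisfies
   the variational inequality that characterizes the projection. In the last
   case, the projection in R^3 exists by compactness and is neither the apex nor
   the point itself; its variational inequality yields [nu, mu > 0] and [s, u]
   with [u] a subgradient of [phi] at [s], [|x| = nu s + mu u],
   [eta = nu - mu phi^*(u)] and [delta = nu phi(s) - mu]. The first two relations
   say that [s] and [u] are the two proximal points of the system, and any
   solution of the system conversely produces the projection, whence
   uniqueness. *)
Require Import Defs.
From mathcomp Require Import all_boot all_order all_algebra.
From mathcomp Require Import all_classical all_reals all_analysis.
From mathcomp Require Import ring lra.
Import Order.TTheory GRing.Theory Num.Theory.
Import numFieldNormedType.Exports.
Local Open Scope classical_set_scope.
Local Open Scope ring_scope.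

(** * Minimization over closed subsets of R^3; proximal points on the line *)

Section real_line.
Context {R : realType}.
Implicit Types (a b c d s t u v w : R).

(** Passage from minimality along a segment, divided by the parameter [t], to a variational
    inequality. *)
Lemma le0_of_small_le (X Y : R) :
  (forall t, 0 < t < 1 -> X <= t * Y) -> X <= 0.
Proof.
move=> XY; rewrite leNgt; apply/negP => X0.
have Y0 : 0 < Y by have := XY 2^-1 ltac:(lra); lra.
(* Any [t] below both 1 and [X / Y] refutes the hypothesis. *)
pose t := X / (2 * Y + 2 * X).
have t0 : 0 < t by rewrite divr_gt0//; lra.
have D0 : 2 * Y + 2 * X != 0 by rewrite gt_eqF//; lra.
have t1 : t < 1 by rewrite ltr_pdivrMr; lra.
have := XY t; rewrite t0 t1 => /(_ isT).
have -> : t * Y = X * (Y / (2 * Y + 2 * X)) by rewrite /t; field.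
rewrite -subr_le0 -[X in X - _]mulr1 -mulrBr pmulr_rle0// subr_le0.
by rewrite ler_pdivlMr; lra.
Qed.

Lemma continuous_coord1 : continuous (fun p : R * R * R => p.1.1).
Proof. by move=> p; apply: cvg_comp; exact: cvg_fst. Qed.

Lemma continuous_coord2 : continuous (fun p : R * R * R => p.1.2).
Proof. by move=> p; apply: cvg_comp; [exact: cvg_fst|exact: cvg_snd]. Qed.

Lemma continuous_coord3 : continuous (fun p : R * R * R => p.2).
Proof. by move=> p; exact: cvg_snd. Qed.

Lemma continuous_sqr_dist (h : R * R * R -> R) w :
  continuous h -> continuous (fun p => (w - h p) ^+ 2).
Proof.
move=> ch p; apply: (@cvg_comp _ _ _ (fun p => w - h p) (fun t => t ^+ 2)).
  by apply: cvgB; [exact: cvg_cst|exact: ch].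
exact: exprn_continuous.
Qed.

Lemma norm_le_sqr_dist w a E : (w - a) ^+ 2 <= E -> `|a| <= `|w| + (1 + E).
Proof.
move=> wE; have -> : a = w - (w - a) by rewrite opprB addrC subrK.
apply: le_trans (ler_normB _ _) _; rewrite lerD2l.
move: wE; rewrite -(real_normK (num_real (w - a))) !expr2.
by have := normr_ge0 (w - a); nra.
Qed.

(** Points of [C] outside the cube of radius [M] have values above [F p0], so the compact part of
    [C] inside it decides. *)
Lemma closed_attains_min (C : set (R * R * R)) (F : R * R * R -> R) (M : R)
    (p0 : R * R * R) :
  closed C -> continuous F -> C p0 ->
  (forall p, C p -> F p <= F p0 ->
    [/\ `|p.1.1| <= M, `|p.1.2| <= M & `|p.2| <= M]) ->
  exists2 p, C p & forall q, C q -> F p <= F q.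
Proof.
move=> clC cF Cp0 bnd.
pose box : set (R * R * R) := (`[-M, M] `*` `[-M, M]) `*` `[-M, M].
have boxP p : [/\ `|p.1.1| <= M, `|p.1.2| <= M & `|p.2| <= M] -> box p.
  by case=> h1 h2 h3; split; [split|]; rewrite /= in_itv/= -ler_norml.
have cbox : compact (C `&` box).
  rewrite setIC; apply: compact_closedI => //.
  by apply: compact_setX; [apply: compact_setX|]; exact: segment_compact.
have [||p] := compact_EVT_min _ cbox (f := F).
- by exists p0; split=> //; apply/boxP/bnd.
- exact: continuous_subspaceT.
rewrite inE => -[Cp _] pmin; exists p => // q Cq.
have Fp0 : F p <= F p0 by apply: pmin; rewrite inE; split=> //; apply/boxP/bnd.
have [Fq|/ltW/(le_trans Fp0)//] := leP (F q) (F p0).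
by apply: pmin; rewrite inE; split=> //; apply/boxP/bnd.
Qed.

Definition subgradient (h : R -> R) s u := forall t, h s + u * (t - s) <= h t.

(** Expanding the square, the objective at [y] exceeds that at [p] by at least [(y - p) ^+ 2 / 2],
    whence minimality and uniqueness. *)
Lemma prox_eq (h : R^o -> R) (l w p : R) :
  (forall t, l * h p + (w - p) * (t - p) <= l * h t) ->
  prox (fun t : R^o => l%:E * (h t)%:E)%E w = p.
Proof.
move=> hp; apply: xget_unique => /=.
  move=> y; rewrite -!EFinM -!EFinD lee_fin !real_normK ?num_real//.
  have := hp y; have := sqr_ge0 (y - p : R); rewrite !expr2; lra.
move=> q /(_ p); rewrite -!EFinM -!EFinD lee_fin !real_normK ?num_real// => hq.
have := hp q; have := sqr_ge0 (q - p : R).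
rewrite le0r => /orP[|q0 hpq]; first by rewrite sqrf_eq0 subr_eq0 => /eqP.
by exfalso; move: q0 hpq hq; rewrite !expr2; lra.
Qed.

End real_line.

(** * Even convex functions on the line, their conjugates, and a cone in R^3 *)

Section conjugate_pair.
Context {R : realType} (r g : R -> R).
Hypothesis r_convex : forall a b t : R, 0 < t < 1 ->
  r (t * a + (1 - t) * b) <= t * r a + (1 - t) * r b.
Hypothesis r_even : forall t : R, r (- t) = r t.
(** With [conjugate_le], this makes [g] the conjugate of [r], as a real function. *)
Hypothesis fenchel_young : forall u t : R, u * t - r t <= g u.
Hypothesis conjugate_le : forall u m : R, (forall t, u * t - r t <= m) -> g u <= m.
Implicit Types (a b c d s t u v w : R).

Lemma even_normr t : r `|t| = r t.
Proof.
by have [t0|t0] := leP 0 t; [rewrite ger0_norm|rewrite ltr0_norm// r_even].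
Qed.

(** If [|a| < |b|], then [|a|] is a convex combination of [|b|] and [- |b|], where [r] takes the
    same value. *)
Lemma even_convex_le a b : `|a| <= `|b| -> r a <= r b.
Proof.
rewrite -(even_normr a) -(even_normr b).
rewrite le_eqVlt => /predU1P[->//|]; set x := `|a|; set y := `|b| => xy.
have x0 : 0 <= x by exact: normr_ge0.
have y0 : 0 < y by lra.
pose t := (x / y + 1) / 2.
have t01 : 0 < t < 1.
  have : x / y < 1 by rewrite ltr_pdivrMr// mul1r.
  have : 0 <= x / y by rewrite divr_ge0// ltW.
  by rewrite /t; lra.
have := r_convex y (- y) t t01.
rewrite r_even -mulrDl (_ : t + (1 - t) = 1); last by ring.
rewrite mul1r; apply: le_trans; rewrite (_ : t * y + _ = x)//.
by rewrite /t; field; rewrite gt_eqF.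
Qed.

Lemma even_convex_ge0 t : r 0 <= r t.
Proof. by apply: even_convex_le; rewrite normr0. Qed.

Lemma conjugate0 : g 0 = - r 0.
Proof.
apply/eqP; rewrite eq_le; apply/andP; split.
  by apply: conjugate_le => t; have := even_convex_ge0 t; lra.
by have := fenchel_young 0 0; lra.
Qed.

Lemma convex_slope_le a b c : a < b -> b < c ->
  (r b - r a) / (b - a) <= (r c - r b) / (c - b).
Proof.
move=> ab bc; pose t := (c - b) / (c - a).
have ca0 : 0 < c - a by lra.
have t0 : 0 < t by rewrite divr_gt0//; lra.
have t1 : t < 1 by rewrite ltr_pdivrMr//; lra.
have := r_convex a c t; rewrite t0 t1 => /(_ isT).
have -> : t * a + (1 - t) * c = b by rewrite /t; field; rewrite gt_eqF.
have -> : t * r a + (1 - t) * r c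
    = ((c - b) * r a + (b - a) * r c) / (c - a).
  by rewrite /t; field; rewrite gt_eqF.
rewrite ler_pdivlMr// => rb.
rewrite ler_pdivrMr ?subr_gt0// mulrAC ler_pdivlMr ?subr_gt0//.
by move: rb; lra.
Qed.

(** The supremum of the left slopes at [s], which every right slope bounds from above. *)
Lemma subgradient_exists s : exists u, subgradient r s u.
Proof.
pose A := [set (r s - r t) / (s - t) | t in [set t | t < s]].
have A0 : A !=set0 by exists ((r s - r (s - 1)) / (s - (s - 1))), (s - 1) => //=; lra.
have ubA t : s < t -> ubound A ((r t - r s) / (t - s)).
  by move=> st _ [t' /= t's <-]; exact: convex_slope_le.
have supA : has_sup A.
  by split=> //; exists ((r (s + 1) - r s) / (s + 1 - s)); apply: ubA; lra.
exists (sup A) => t; have [ts|st|->] := ltgtP t s; last by rewrite subrr; lra.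
- have : (r s - r t) / (s - t) <= sup A by apply: sup_ubound supA.2 _ _; exists t.
  by rewrite ler_pdivrMr ?subr_gt0//; lra.
- have := ge_sup A0 (ubA t st).
  by rewrite ler_pdivlMr ?subr_gt0//; lra.
Qed.

Lemma conjugate_subgradient s u : subgradient r s u -> g u = u * s - r s.
Proof.
move=> us; apply/eqP; rewrite eq_le fenchel_young andbT.
by apply: conjugate_le => t; have := us t; lra.
Qed.

Lemma subgradient_conjugate s u : subgradient r s u -> subgradient g u s.
Proof.
move=> us v; rewrite (conjugate_subgradient s u us).
by have := fenchel_young v s; lra.
Qed.

(* By Fenchel-Moreau this is the epigraph of the perspective of [r]; in this
   form, it is an intersection of closed half-spaces. *)
Definition dual_cone : set (R * R * R) :=
  [set p | 0 <= p.1.2 /\ forall u, u * p.1.1 - g u * p.1.2 <= p.2].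

(** For a subgradient [u] of [r] at [a / b], the dual bound [u * a - g u * b] equals
    [b * r (a / b)]. *)
Lemma dual_cone_pos a b d : 0 < b -> dual_cone (a, b, d) <-> b * r (a / b) <= d.
Proof.
move=> b0; rewrite /dual_cone /=; split.
  move=> [_ /=]; have [u us] := subgradient_exists (a / b).
  move=> /(_ u); rewrite (conjugate_subgradient _ _ us).
  have -> : u * a - (u * (a / b) - r (a / b)) * b = b * r (a / b).
    by field; rewrite gt_eqF.
  by [].
move=> rd; split=> [|u]; first exact: ltW.
have := fenchel_young u (a / b); rewrite -(ler_pM2l b0).
have -> : b * (u * (a / b) - r (a / b)) = u * a - b * r (a / b).
  by field; rewrite gt_eqF.
by lra.
Qed.

Lemma dual_cone_zero a d : dual_cone (a, 0, d) -> a = 0 /\ 0 <= d.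
Proof.
move=> [_ /= h]; have d0 : 0 <= d by have := h 0; rewrite mulr0 mul0r subr0.
split=> //; apply/eqP; apply: contraT => a0.
have := h ((d + 1) / a); rewrite mulr0 subr0 divfK//; lra.
Qed.

Lemma dual_cone_closed: closed dual_cone.
Proof.
have -> : dual_cone = [set p | 0 <= p.1.2] `&`
    \bigcap_u [set p | u * p.1.1 - g u * p.1.2 - p.2 <= 0].
  apply/seteqP; split=> p /= [p0 h]; split=> // u.
    by move=> _ /=; rewrite subr_le0.
  by rewrite -subr_le0; exact: h.
apply: closedI.
  exact: (iffLR (continuous_closedP _) continuous_coord2 _ (@closed_ge R 0)).
apply: closed_bigI => u _.
suff /continuous_closedP/(_ _ (@closed_le R 0)) : continuous
    (fun p : R * R * R => u * p.1.1 - g u * p.1.2 - p.2) by [].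
move=> p; apply: cvgB; last exact: continuous_coord3.
apply: cvgB; (apply: cvgM; first exact: cvg_cst).
  exact: continuous_coord1.
exact: continuous_coord2.
Qed.

(** The proximal objective is minimized over the epigraph of [r], which is closed as the slice
    [b = 1] of [dual_cone]; moving from the minimizer towards [t] gives the inequality. *)
Lemma prox_subgradient_exists l w : 0 < l ->
  exists s, forall t, l * r s + (w - s) * (t - s) <= l * r t.
Proof.
move=> l0.
pose C := dual_cone `&` [set p : R * R * R | p.1.2 = 1].
pose F (p : R * R * R) := l * p.2 + 2^-1 * (w - p.1.1) ^+ 2.
have C_le a d : C (a, 1, d) <-> r a <= d.
  rewrite /C /=; have := dual_cone_pos a 1 d ltr01.
  by rewrite divr1 mul1r => ->; split=> [[]|].
have clC : closed C.
  apply: closedI; first exact: dual_cone_closed.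
  exact: (iffLR (continuous_closedP _) continuous_coord2 _ (@closed_eq R 1)).
have cF : continuous F.
  move=> p; apply: cvgD; (apply: cvgM; first exact: cvg_cst).
    exact: continuous_coord3.
  exact: continuous_sqr_dist _ _ continuous_coord1 _.
(* On the sublevel set, [r 0 <= d] gives [(w - a) ^+ 2 <= E]. *)
pose E := 2 * l * (r w - r 0).
have E0 : 0 <= E by have := even_convex_ge0 w; rewrite /E; nra.
pose M := `|w| + (1 + E) + `|r 0| + `|r w| + 1.
have [||[[a b] d] Cp Fmin] := closed_attains_min C F M (w, 1, r w) clC cF.
- by apply/C_le.
- move=> [[a b] d] Cp; have /= b1 := Cp.2; move: Cp; rewrite b1 => /C_le ra.
  rewrite /F /= subrr expr0n mulr0 addr0 => Fp.
  have r0a := even_convex_ge0 a.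
  have sq := sqr_ge0 (w - a).
  have dw : d <= r w by rewrite -(ler_pM2l l0); lra.
  have aw : (w - a) ^+ 2 <= E by rewrite /E; nra.
  have := norm_le_sqr_dist w a E aw.
  have := normr_ge0 w; have := normr_ge0 (r 0); have := normr_ge0 (r w).
  have := ler_norm (r w); have := lerNnormlW (lexx `|r 0|).
  rewrite /M normr1 => *; split; [lra|lra|].
  by rewrite ler_norml; apply/andP; split; lra.
- have /= b1 := Cp.2; move: Cp Fmin; rewrite b1 => /C_le ra Fmin.
have rmin t : l * r a + 2^-1 * (w - a) ^+ 2 <= l * r t + 2^-1 * (w - t) ^+ 2.
  have /Fmin : C (t, 1, r t) by apply/C_le.
  rewrite /F /=; apply: le_trans; rewrite lerD2r ler_pM2l//.
exists a => t; rewrite -subr_le0.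
apply: (le0_of_small_le _ (2^-1 * (t - a) ^+ 2)) => th th01.
have h2 := rmin (th * t + (1 - th) * a).
have h1 := r_convex t a th th01; rewrite -(ler_pM2l l0) in h1.
case/andP: th01 => th0 _; rewrite -(ler_pM2l th0).
by move: h1 h2; rewrite !expr2; lra.
Qed.

(** * Projection onto the cone and its optimality conditions *)

Lemma dual_cone_convex p q th : dual_cone p -> dual_cone q -> 0 < th < 1 ->
  dual_cone (p + th *: (q - p)).
Proof.
move: p q => [[a b] d] [[a' b'] d'] [/= b0 p1] [/= b0' q1] th01.
split=> /= [|u]; rewrite /GRing.scale/=; first nra.
by have := p1 u; have := q1 u; nra.
Qed.

Lemma dual_cone_projection (x e d : R) : exists a b c : R, dual_cone (a, b, c) /\
  forall a' b' c' : R, dual_cone (a', b', c') ->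
    (x - a) * (a' - a) + (e - b) * (b' - b) + (d - c) * (c' - c) <= 0.
Proof.
pose F (p : R * R * R) :=
  (x - p.1.1) ^+ 2 + (e - p.1.2) ^+ 2 + (d - p.2) ^+ 2.
have cF : continuous F.
  move=> p; apply: cvgD; first apply: cvgD.
  - exact: continuous_sqr_dist _ _ continuous_coord1 _.
  - exact: continuous_sqr_dist _ _ continuous_coord2 _.
  - exact: continuous_sqr_dist _ _ continuous_coord3 _.
pose E := x ^+ 2 + e ^+ 2 + d ^+ 2.
pose M := `|x| + `|e| + `|d| + (1 + E).
have [||[[a b] c] Cp Fmin] :=
  closed_attains_min dual_cone F M (0, 0, 0) dual_cone_closed cF.
- by split=> //= u; rewrite !mulr0 subr0.
- move=> [[a b] c] _; rewrite /F /= !subr0 -/E => FE.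
  have := sqr_ge0 (x - a); have := sqr_ge0 (e - b); have := sqr_ge0 (d - c).
  move=> h1 h2 h3.
  have := norm_le_sqr_dist x a E ltac:(lra).
  have := norm_le_sqr_dist e b E ltac:(lra).
  have := norm_le_sqr_dist d c E ltac:(lra).
  have := normr_ge0 x; have := normr_ge0 e; have := normr_ge0 d.
  by rewrite /M => *; split; lra.
exists a, b, c; split=> // a' b' c' Cq.
apply: (le0_of_small_le _
  (2^-1 * ((a' - a) ^+ 2 + (b' - b) ^+ 2 + (c' - c) ^+ 2))) => th th01.
have := Fmin _ (dual_cone_convex _ _ th Cp Cq th01).
rewrite /F /= /GRing.scale/=.
case/andP: th01 => th0 _ h; rewrite -(ler_pM2l th0).
by move: h; rewrite !expr2; lra.
Qed.

(* Optimality conditions for the projection of [(x, e, d)] onto [dual_cone],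
   when it is neither the apex nor [(x, e, d)] itself: the residual is
   [mu * (u, - g u, -1)], a normal vector at [nu * (s, 1, r s)]. *)
Lemma kkt_exists (x e d : R) : 0 < x ->
  (0 < e -> d < e * r (x / e)) ->
  (d < 0 -> 0 < e - d * g (x / - d)) ->
  exists nu mu s u : R, [/\ 0 < nu, 0 < mu, subgradient r s u,
    x = nu * s + mu * u & e = nu - mu * g u /\ d = nu * r s - mu].
Proof.
move=> x0 he hd.
have [a [b [c [Cp vi]]]] := dual_cone_projection x e d.
have Cs s t : 0 < t -> dual_cone (t * s, t, t * r s).
  by move=> t0; apply/dual_cone_pos => //; rewrite mulrAC divff ?mul1r// gt_eqF.
have C0 : dual_cone (0, 0, 0) by split=> //= u; rewrite !mulr0 subr0.
have Cup t : 1 <= t -> dual_cone (a, b, c) -> dual_cone (t * a, t * b, t * c).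
  move=> t1 [/= b0 hu]; split=> /= [|u]; first nra.
  by have := hu u; nra.
(* Tests at 0 and at twice the projection: the residual is orthogonal to the projection. *)
have vi0 : (x - a) * a + (e - b) * b + (d - c) * c = 0.
  have := vi _ _ _ C0; have := vi _ _ _ (Cup 2 ltac:(lra) Cp); lra.
have vis s : (x - a) * s + (e - b) + (d - c) * r s <= 0.
  by have := vi _ _ _ (Cs s 1 ltr01); rewrite !mul1r; lra.
have cd : d <= c.
  have Cp1 : dual_cone (a, b, c + 1).
    by case: Cp => /= b0 hu; split=> //= u; have := hu u; lra.
  have := vi _ _ _ Cp1; lra.
have b_ge0 : 0 <= b by case: Cp.
have [b0|b0] := ltP 0 b; last first.
  (* The projection is [(0, 0, c)]. If [c = d], an affine function of slope [x > 0] would be bounded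
     above; otherwise the projection is the apex, against [hd]. *)
  have bE : b = 0 by apply/eqP; rewrite eq_le b0.
  move: Cp vi0 vis; rewrite bE => /dual_cone_zero[-> c0].
  rewrite !subr0 !mulr0 !add0r => vi0 vis.
  have noaff y : ~ forall s, x * s + y <= 0.
    move=> /(_ ((1 - y) / x)); rewrite mulrC divfK ?gt_eqF//; lra.
  exfalso; have [dc|dc] := eqVneq c d.
    by apply: (noaff e) => s; have := vis s; rewrite dc subrr mul0r addr0.
  have c_eq0 : c = 0.
    move/eqP: vi0; rewrite mulf_eq0 subr_eq0 eq_sym (negPf dc) => /eqP//.
  have d0 : d < 0 by move: dc cd; rewrite c_eq0 => dc cd; rewrite lt_neqAle eq_sym dc.
  have := hd d0; apply/negP; rewrite -leNgt.
  have nd0 : 0 < - d by lra.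
  have : g (x / - d) <= e / d.
    apply: conjugate_le => s; have := vis s; rewrite c_eq0 subr0 => h.
    rewrite -(ler_pM2l nd0).
    have -> : - d * (x / - d * s - r s) = x * s + d * r s by field; lra.
    have -> : - d * (e / d) = - e by field; lra.
    by lra.
  by rewrite -(ler_pM2l nd0) (_ : - d * (e / d) = - e); [lra|field; lra].
have rc : b * r (a / b) <= c by apply/dual_cone_pos.
have visb := vis (a / b).
have mulab : b * (a / b) = a by rewrite mulrC divfK// gt_eqF.
(* With [c = d] the residual would vanish, so that [(x, e, d)] would lie in the cone, against
   [he]. *)
have dc : d < c.
  rewrite lt_neqAle cd andbT; apply/negP => /eqP dc.
  have xa : x = a.
    apply/eqP; rewrite -subr_eq0; apply: contraT => xa; exfalso.
    have := vis ((1 - (e - b)) / (x - a)).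
    by rewrite dc subrr mul0r mulrC divfK//; lra.
  have eb : e = b.
    move/eqP: vi0; rewrite xa dc !subrr !mul0r add0r addr0 mulf_eq0 subr_eq0.
    by rewrite (gt_eqF b0) orbF => /eqP.
  have := he ltac:(lra); rewrite eb xa dc; lra.
(* Comparing [vi0] with [b] times [visb], where [d - c < 0], gives the missing inequality
   [c <= b * r (a / b)]. *)
have rcE : c = b * r (a / b).
  apply/eqP; rewrite eq_le rc andbT.
  have : b * ((x - a) * (a / b) + (e - b) + (d - c) * r (a / b)) <= 0.
    by rewrite pmulr_rle0.
  have -> : b * ((x - a) * (a / b) + (e - b) + (d - c) * r (a / b))
      = (x - a) * a + (e - b) * b + (d - c) * (b * r (a / b)).
    by field; lra.
  by move: vi0 dc; nra.
have mu0 : 0 < c - d by lra.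
have tight : (x - a) * (a / b) + (e - b) + (d - c) * r (a / b) = 0.
  apply: (mulfI (lt0r_neq0 b0)); rewrite mulr0 -vi0 {3}rcE.
  by field; rewrite gt_eqF.
have [u muu] : exists u, (c - d) * u = x - a.
  by exists ((x - a) / (c - d)); rewrite mulrC divfK// gt_eqF.
have us : subgradient r (a / b) u.
  move=> t; rewrite -(ler_pM2l mu0) mulrDr mulrA muu.
  by have := vis t; move: tight; lra.
exists b, (c - d), (a / b), u; split=> //.
  by rewrite muu mulab; ring.
split; last by rewrite -rcE; ring.
rewrite (conjugate_subgradient _ _ us) mulrBr (mulrA (c - d)) muu.
by move: tight; lra.
Qed.

(** The remainders at the two points are [mu / nu * u] and [nu / mu * s], while [u] is a subgradient
    of [r] at [s] and [s] one of [g] at [u]. *)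
Lemma kkt_prox (nu mu s u : R) : 0 < nu -> 0 < mu -> subgradient r s u ->
  prox (fun t : R^o => (mu / nu)%:E * (r t)%:E)%E ((nu * s + mu * u) / nu) = s
  /\ prox (fun t : R^o => (nu / mu)%:E * (g t)%:E)%E ((nu * s + mu * u) / mu)
     = u.
Proof.
move=> nu0 mu0 us; split; apply: prox_eq => t.
  have -> : (nu * s + mu * u) / nu - s = mu / nu * u.
    by field; rewrite gt_eqF.
  by rewrite -(mulrA (mu / nu)) -mulrDr ler_pM2l ?divr_gt0.
have -> : (nu * s + mu * u) / mu - u = nu / mu * s.
  by field; rewrite gt_eqF.
rewrite -(mulrA (nu / mu)) -mulrDr ler_pM2l ?divr_gt0//.
exact: (subgradient_conjugate _ _ us).
Qed.

(** Take for [s] the proximal point of the system and for [u] the scaled remainder. As [nu] and [mu]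
    are arbitrary positive numbers, this applies to any candidate solution in the uniqueness
    proof. *)
Lemma kkt_of_ratio (nu mu x : R) : 0 < nu -> 0 < mu ->
  exists s u : R, subgradient r s u /\ x = nu * s + mu * u.
Proof.
move=> nu0 mu0.
have [s hs] := prox_subgradient_exists (mu / nu) (x / nu) (divr_gt0 mu0 nu0).
exists s, ((x - nu * s) / mu); split; last by field; rewrite gt_eqF.
move=> t; have := hs t.
have -> : x / nu - s = mu / nu * ((x - nu * s) / mu).
  by field; rewrite !gt_eqF.
by rewrite -(mulrA (mu / nu)) -mulrDr ler_pM2l ?divr_gt0.
Qed.

End conjugate_pair.

(** * Cauchy-Schwarz and the variational inequality of a projection *)

Section hilbert_projection.
Context {R : realType} {G : hilbertType R}.
Implicit Types (x y z p : G) (C : set G).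

Lemma sqr_normB x y : `|x - y| ^+ 2 = `|x| ^+ 2 - 2 * inner x y + `|y| ^+ 2.
Proof.
by rewrite -!innerxx innerBl !innerBr (innerC y x); ring.
Qed.

Lemma inner0l y : inner 0 y = 0.
Proof. by rewrite -(scale0r 0) innerZl mul0r. Qed.

Lemma cauchy_schwarz x y : `|inner x y| <= `|x| * `|y|.
Proof.
rewrite -(@ler_pXn2r _ 2) ?nnegrE ?mulr_ge0// real_normK ?num_real// exprMn.
have [->|x0] := eqVneq x 0; first by rewrite inner0l expr0n mulr_ge0// sqr_ge0.
have nx0 : 0 < `|x| ^+ 2 by rewrite exprn_gt0// normr_gt0.
have := sqr_ge0 `|y - (inner x y / `|x| ^+ 2) *: x|.
rewrite sqr_normB innerZr normrZ exprMn real_normK ?num_real// (innerC y x).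
rewrite -(pmulr_rge0 _ nx0); set i := inner x y; set k := `|x| ^+ 2.
have -> : k * (`|y| ^+ 2 - 2 * (i / k * i) + (i / k) ^+ 2 * k)
    = k * `|y| ^+ 2 - i ^+ 2 by field; rewrite gt_eqF.
by rewrite subr_ge0.
Qed.

(** The inequality gives [|z - p|^2 + |y - p|^2 <= |z - y|^2] on [C], hence the minimality of [p]
    and the uniqueness that [xget] calls for. *)
Lemma metric_proj_eq C z p : C p ->
  (forall y, C y -> inner (z - p) (y - p) <= 0) -> metric_proj C z = p.
Proof.
move=> Cp vi.
have zy y : C y -> `|z - p| ^+ 2 + `|y - p| ^+ 2 <= `|z - y| ^+ 2.
  move=> Cy; have -> : z - y = z - p - (y - p) by rewrite opprB addrA subrK.
  by rewrite [leRHS]sqr_normB; have := vi y Cy; lra.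
apply: xget_unique => /=.
  split=> // y Cy; rewrite -(@ler_pXn2r _ 2) ?nnegrE//.
  by have := zy y Cy; have := sqr_ge0 `|y - p|; lra.
move=> q [Cq /(_ p Cp)]; rewrite -(@ler_pXn2r _ 2) ?nnegrE// => qp.
have qp0 : `|q - p| ^+ 2 <= 0 by have := zy q Cq; lra.
by apply/eqP; rewrite -subr_eq0 -normr_eq0 -sqrf_eq0 eq_le qp0 sqr_ge0.
Qed.

End hilbert_projection.

(** * Radial functions: description of the epigraph, and projections onto it *)

Section radial.
Context {R : realType} {G : hilbertType R} (r : R -> R).
Hypothesis r_supercoercive : forall A : R,
  exists2 M : R, 0 < M & forall t : R, M <= `|t| -> A * `|t| <= r t.

(** For [y != 0] and large [t], [|x0 + t *: y|] is at least half of [t * |y|], so supercoercivity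
    takes the quotient above any [A]. *)
Lemma recession_radial (y : G) :
  recession (fun y : G => (r `|y|)%:E) y = if y == 0 then 0%E else +oo%E.
Proof.
rewrite /recession; set x0 := xget _ _.
have [->|y0] := eqVneq y 0.
  apply/cvg_lim => //; apply: cvg_near_cst; near=> t.
  by rewrite scaler0 addr0 subee// mul0e.
apply/cvg_lim => //; apply/cvgeyPge => A.
have ny : 0 < `|y| by rewrite normr_gt0.
have [M M0 rM] := r_supercoercive (2 * (`|A| + `|r `|x0| |) / `|y|).
near=> t.
have t1 : 1 <= t by near: t; exact: nbhs_pinfty_ge.
have t2 : 2 * `|x0| / `|y| <= t by near: t; apply: nbhs_pinfty_ge; rewrite num_real.
have t3 : 2 * M / `|y| <= t by near: t; apply: nbhs_pinfty_ge; rewrite num_real.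
have t0 : 0 < t by lra.
rewrite -EFinB -EFinM lee_fin ler_pdivlMr//.
move: t2 t3; rewrite !ler_pdivrMr// => t2 t3.
have ty : t * `|y| / 2 <= `|x0 + t *: y|.
  have : `|t *: y| <= `|x0 + t *: y| + `|x0|.
    by rewrite -{1}(addKr x0 (t *: y)) addrC ler_normB.
  by rewrite normrZ gtr0_norm//; lra.
set B := `|A| + `|r `|x0| | in rM *.
have B0 : 0 <= B by rewrite addr_ge0.
have := rM `|x0 + t *: y|; rewrite normr_id => /(_ ltac:(lra)).
have h : B * t <= 2 * B / `|y| * `|x0 + t *: y|.
  rewrite mulrAC ler_pdivlMr//; nra.
move=> /(le_trans h); move=> h'.
have := ler_norm A; have := ler_norm (r `|x0|); have := normr_ge0 (r `|x0|).
rewrite /B in h'; nra.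
Unshelve. all: by end_near. Qed.

Hypothesis r_convex : forall a b t : R, 0 < t < 1 ->
  r (t * a + (1 - t) * b) <= t * r a + (1 - t) * r b.
Hypothesis r_even : forall t : R, r (- t) = r t.
Variable g : R -> R.
Hypothesis fenchel_young : forall u t : R, u * t - r t <= g u.
Hypothesis conjugate_le : forall u m : R, (forall t : R, u * t - r t <= m) -> g u <= m.

Lemma perspective_radial_le (y : G) (b d : R) :
  (perspective (fun y : G => (r `|y|)%:E) (y, b) <= d%:E)%E
  <-> dual_cone g (`|y|, b, d).
Proof.
rewrite /perspective; have [b0|b0|<-] := ltgtP 0 b.
- rewrite -EFinM lee_fin normrZ gtr0_norm ?invr_gt0// [_^-1 * _]mulrC.
  exact: iff_sym (dual_cone_pos r g r_convex fenchel_young conjugate_le _ _ _ b0).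
- rewrite leye_eq; split=> // -[/= b1 _]; lra.
rewrite recession_radial; case: eqVneq => [->|y0].
  rewrite lee_fin normr0; split=> [d0|/dual_cone_zero[]//].
  by split=> //= u; rewrite !mulr0 subr0.
by rewrite leye_eq; split=> // /dual_cone_zero[/eqP]; rewrite normr_eq0 (negPf y0).
Qed.

Lemma conjugate_even u : g (- u) = g u.
Proof.
apply/eqP; rewrite eq_le; apply/andP; split; apply: conjugate_le => t.
  by have := fenchel_young u (- t); rewrite r_even; lra.
by have := fenchel_young (- u) (- t); rewrite r_even; lra.
Qed.

(** By evenness of [g]; this spares a sign discussion for [s] in the last case. *)
Lemma dual_cone_normP a b d : dual_cone g (`|a|, b, d) <-> dual_cone g (a, b, d).
Proof.
have [a0|a0] := leP 0 a; first by rewrite ger0_norm.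
rewrite ltr0_norm//; split=> -[/= b0 h]; split=> //= u.
  by have := h (- u); rewrite conjugate_even; lra.
by have := h (- u); rewrite conjugate_even; lra.
Qed.

(** The radial reduction: the component of [y] along [x] is at most [|y|] in absolute value, so it
    can replace [|y|] in the dual inequalities. *)
Lemma dual_cone_inner (x y : G) (b d : R) : `|x| != 0 ->
  dual_cone g (`|y|, b, d) -> forall u, u * (inner x y / `|x|) - g u * b <= d.
Proof.
move=> x0 [/= b0 h] u.
have nx : 0 < `|x| by rewrite normr_gt0 -normr_eq0.
have -> : g u = g `|u|.
  by have [u0|u0] := leP 0 u; [rewrite ger0_norm|rewrite ltr0_norm// conjugate_even].
apply: le_trans (h `|u|); rewrite lerD2r.
apply: le_trans (ler_norm _) _; rewrite normrM ler_wpM2l//.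
rewrite normrM normfV normr_id ler_pdivrMr// mulrC; exact: cauchy_schwarz.
Qed.

Local Notation f := (fun y : G => (r `|y|)%:E).
Local Notation P := (metric_proj (epi (perspective f))).

Lemma epi_radialP (y : G) (b d : R) :
  epi (perspective f) (y, b, d) <-> dual_cone g (`|y|, b, d).
Proof. exact: perspective_radial_le. Qed.

Lemma proj_epi_radial (x y : G) (e d b c : R) :
  dual_cone g (`|y|, b, c) ->
  (forall (y' : G) (b' c' : R), dual_cone g (`|y'|, b', c') ->
    inner (x - y) (y' - y) + (e - b) * (b' - b) + (d - c) * (c' - c) <= 0) ->
  P (x, e, d) = (y, b, c).
Proof.
move=> Cp vi; apply: metric_proj_eq; first exact/epi_radialP.
by move=> [[y' b'] c'] /epi_radialP; exact: vi.
Qed.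

Lemma proj_epi_max (x : G) (e d : R) : dual_cone g (`|x|, Num.max e 0, d) ->
  P (x, e, d) = (x, Num.max e 0, d).
Proof.
move=> Cx; apply: proj_epi_radial => // y b c [/= b0 _].
rewrite !subrr inner0l !mul0r add0r addr0.
by have [e0|e0] := ltP e 0; [nra|rewrite subrr mul0r].
Qed.

Lemma proj_epi_polar (x : G) (e d : R) : d < 0 ->
  e - d * g (`|x| / - d) <= 0 -> P (x, e, d) = (0, 0, 0).
Proof.
move=> d0 ed; apply: proj_epi_radial => [|y b c [/= b0 h]].
  by rewrite normr0; split=> //= u; rewrite !mulr0 subr0.
(* This dual inequality, multiplied by [- d], bounds [|x| * |y|], hence the inner product. *)
rewrite !subr0; have := h (`|x| / - d).
have -> : `|x| / - d * `|y| = `|x| * `|y| / - d by rewrite mulrAC.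
rewrite lerBlDr ler_pdivrMr ?oppr_gt0// => hy.
have := cauchy_schwarz x y; rewrite ler_norml => /andP[_].
nra.
Qed.

(** On the axis the cone reads [b >= 0] and [- c * b <= d], as [c] is the minimum of [g]. The
    projection lies on the ray of [(1, - c)], at coordinate [l], with residual [k * (c, 1)],
    [k <= 0]. *)
Lemma proj_epi_axis (e d : R) : ~ dual_cone g (0, Num.max e 0, d) ->
  0 < e - d * g 0 ->
  P (0, e, d) = (0, (e - d * g 0) / (1 + g 0 ^+ 2),
    g 0 * (d * g 0 - e) / (1 + g 0 ^+ 2)).
Proof.
set c := g 0 => nC ed.
have c1 : 0 < 1 + c ^+ 2 by have := sqr_ge0 c; lra.
have c_le u : c <= g u.
  rewrite /c (conjugate0 r g r_convex r_even fenchel_young conjugate_le).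
  by have := fenchel_young u 0; lra.
pose l := (e - d * c) / (1 + c ^+ 2).
pose k := (e * c + d) / (1 + c ^+ 2).
have l0 : 0 < l by rewrite divr_gt0.
have k0 : k <= 0.
  rewrite pmulr_lle0 ?invr_gt0//; rewrite leNgt; apply/negP => ecd; apply: nC.
  have [e0|e0] := ltP e 0.
    have d0 : 0 <= d by nra.
    by split=> //= u; rewrite !mulr0 subr0.
  by split=> //= u; have := c_le u; nra.
have -> : c * (d * c - e) / (1 + c ^+ 2) = - (c * l).
  by rewrite /l; field; rewrite gt_eqF.
rewrite -/l; apply: proj_epi_radial => [|y b c' [/= b0 h]].
  by rewrite normr0; split=> /= [|u]; [lra|have := c_le u; nra].
have -> : e - l = k * c by rewrite /l /k; field; rewrite gt_eqF.
have -> : d - - (c * l) = k by rewrite /l /k; field; rewrite gt_eqF.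
have := h 0; rewrite subrr inner0l -/c.
nra.
Qed.

(** The residual is [mu] times [(u x / |x|, - g u, -1)]. The dual inequality at [u] makes its
    product with each point of the cone nonpositive, and [g u = u * s - r s] makes it orthogonal to
    the projection. *)
Lemma proj_epi_kkt (x : G) (nu mu s u : R) : x != 0 -> 0 < nu -> 0 < mu ->
  subgradient r s u -> `|x| = nu * s + mu * u ->
  P (x, nu - mu * g u, nu * r s - mu)
  = ((s * nu / `|x|) *: x, nu, nu * r s).
Proof.
move=> x0 nu0 mu0 us nx.
have x1 : `|x| != 0 by rewrite normr_eq0.
have gu := conjugate_subgradient r g fenchel_young conjugate_le _ _ us.
apply: proj_epi_radial => [|y b c Cy].
  rewrite normrZ -{2}(normr_id x) -normrM divfK//; apply/dual_cone_normP.
  apply/(dual_cone_pos r g r_convex fenchel_young conjugate_le) => //.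
  by rewrite mulfK ?gt_eqF.
set k := s * nu / `|x|.
have -> : x - k *: x = (mu * u / `|x|) *: x.
  rewrite -{1}(scale1r x) -scalerBl; congr (_ *: _).
  by rewrite /k -{1}(divff x1) -mulrBl {1}nx; congr (_ / _); ring.
rewrite innerZl innerBr innerZr innerxx.
have := dual_cone_inner x y b c x1 Cy u.
set i := inner x y; rewrite -(ler_pM2l mu0) => h.
have -> : mu * u / `|x| * (i - k * `|x| ^+ 2)
    = mu * (u * (i / `|x|)) - mu * u * s * nu by rewrite /k; field.
by move: h; rewrite gu; nra.
Qed.

End radial.

(** * Reduction of the extended-real data to real-valued functions *)

Lemma Gamma0_finite (R : realType) (phi : R^o -> \bar R) :
  Gamma0 phi -> dom phi = [set: R^o] ->
  exists r : R -> R, phi = (fun t => (r t)%:E).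
Proof.
move=> [pN _ _ _] domphi; exists (fine \o phi); apply/funext => t; rewrite /= fineK// fin_numE pN/=.
have : dom phi t by rewrite domphi.
by rewrite /dom /= lt_neqAle => /andP[].
Qed.

Lemma supercoercive_real (R : realType) (r : R -> R) :
  supercoercive (fun t : R^o => (r t)%:E) ->
  forall A : R,
    exists2 M : R, 0 < M & forall t : R, M <= `|t| -> A * `|t| <= r t.
Proof.
move=> [/cvgeyPge cp /cvgeyPge cn] A.
have [a [_ ha]] := cp A; have [b [_ hb]] := cn A.
exists (`|a| + `|b| + 1); first by have := normr_ge0 a; have := normr_ge0 b; lra.
move=> t tM.
have [ab1 ab2] : a <= `|a| /\ - `|b| <= b.
  by split; [exact: ler_norm|rewrite lerNl -normrN ler_norm].
have a0 := normr_ge0 a; have b0 := normr_ge0 b.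
have t0 : 0 < `|t| by lra.
suff : (A%:E <= (r t)%:E * (`|t|^-1)%:E)%E by rewrite -EFinM lee_fin ler_pdivlMr.
have [t1|t1] := leP 0 t.
  by apply: ha; move: tM; rewrite (ger0_norm t1); lra.
by apply: hb; move: tM; rewrite (ltr0_norm t1); lra.
Qed.

Lemma conjugate_real (R : realType) (r : R -> R) :
  (forall t, r 0 <= r t) ->
  (forall A : R,
    exists2 M : R, 0 < M & forall t : R, M <= `|t| -> A * `|t| <= r t) ->
  exists g : R -> R,
    [/\ conjugate (fun t : R^o => (r t)%:E) = (fun u => (g u)%:E),
        forall u t : R, u * t - r t <= g u &
        forall u m : R, (forall t : R, u * t - r t <= m) -> g u <= m].
Proof.
move=> r0 super; pose h (t : R^o) := (r t)%:E.
have hE u m : (conjugate h u <= m%:E)%E <-> forall t : R, u * t - r t <= m.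
  split=> [hm t|hm].
    rewrite -lee_fin mulrC; apply: le_trans hm.
    by apply: ereal_sup_ubound; exists t.
  apply: ge_ereal_sup => _ [t _ <-]; rewrite /h -EFinB lee_fin.
  by have := hm t; rewrite /inner /= /real_inner mulrC.
have lo u : ((- r 0)%:E <= conjugate h u)%E.
  apply: ereal_sup_ubound; exists 0 => //.
  by rewrite /h -EFinB /inner /= /real_inner mul0r sub0r.
have conj_fin u : conjugate h u \is a fin_num.
  have [M M0 hM] := super `|u|.
  (* For [|t| >= M], supercoercivity with slope [|u|] makes [u * t - r t] nonpositive; for
     [|t| < M], use [r 0 <= r t]. *)
  have /hE hi : forall t : R, u * t - r t <= `|u| * M + `|r 0|.
    move=> t; have uM : 0 <= `|u| * M by rewrite mulr_ge0// ltW.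
    have := ler_norm (- r 0); have := normr_ge0 (r 0); rewrite normrN => n0 n1.
    have ut : u * t <= `|u| * `|t| by rewrite -normrM ler_norm.
    have [tM|/hM] := ltP `|t| M; last by lra.
    have := r0 t; have : `|u| * `|t| <= `|u| * M by rewrite ler_wpM2l// ltW.
    by lra.
  by apply/fin_real/andP; split; [apply: lt_le_trans (lo u)|apply: le_lt_trans hi _]; rewrite ?ltNyr ?ltry.
exists (fun u => fine (conjugate h u)); split.
- by apply/funext => u; rewrite fineK.
- by move=> u; apply/hE; rewrite fineK.
- by move=> u m um; rewrite -lee_fin fineK//; apply/hE.
Qed.

(** * The four cases of the projection formula, and uniqueness of the pair [nu], [mu] *)

Theorem proposition3p2 (R : realType) (H : hilbertType R)
    (phi : R^o -> \bar R) (phi_Gamma0 : Gamma0 phi)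
    (phi_even : forall xi, phi (- xi) = phi xi)
    (phi_supercoercive : supercoercive phi)
    (dom_phi : dom phi = [set: R^o])
    (x : H) (eta delta : R) :
  let f : H -> \bar R := fun y => phi `|y| in
  let P : H \oplus R^o \oplus R^o -> H \oplus R^o \oplus R^o :=
    metric_proj (epi (perspective f)) in
  let psi := perspective phi (`|x|, Num.max eta 0) in
  let case1 := (psi <= delta%:E)%E in
  let case2 :=
    [/\ (delta%:E < psi)%E, delta < 0 &
        (eta%:E - delta%:E * conjugate phi (`|x| / - delta)%R <= 0)%E] in
  let case3 :=
    [/\ (delta%:E < psi)%E,
        (0 < eta%:E - delta%:E * conjugate phi 0%R)%E & x = 0] in
  let c := fine (conjugate phi 0) in
  let solution (nu mu : R) :=
    [/\ 0 < nu, 0 < mu,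
        (mu + delta)%:E
          = (nu%:E * phi (prox (fun xi => (mu / nu)%:E * phi xi)
                               (`|x| / nu)%R))%E &
        (nu - eta)%:E
          = (mu%:E * conjugate phi
               (prox (fun xi => (nu / mu)%:E * conjugate phi xi)
                     (`|x| / mu)%R))%E] in
  [/\ case1 -> P (x, eta, delta) = (x, Num.max eta 0, delta),
      case2 -> P (x, eta, delta) = (0, 0, 0),
      case3 ->
        P (x, eta, delta)
          = (0, (eta - delta * c) / (1 + c ^+ 2),
             c * (delta * c - eta) / (1 + c ^+ 2)) &
      ~ case1 -> ~ case2 -> ~ case3 ->
        exists nu mu : R,
          [/\ solution nu mu,
              forall nu' mu', solution nu' mu' -> nu' = nu /\ mu' = mu &
              P (x, eta, delta)
                = ((prox (fun xi => ((mu / nu)%:E * phi xi)%E) (`|x| / nu)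
                      * nu / `|x|) *: x,
                   nu, delta + mu)]].
Proof.
have [r phiE] := Gamma0_finite R phi phi_Gamma0 dom_phi; subst phi.
have r_convex (a b t : R) : 0 < t < 1 ->
    r (t * a + (1 - t) * b) <= t * r a + (1 - t) * r b.
  by move=> t01; case: phi_Gamma0 => _ _ _ /(_ a b t t01); rewrite -!EFinM -EFinD lee_fin.
have r_even (t : R) : r (- t) = r t by have [] := phi_even t.
have r_super := supercoercive_real R r phi_supercoercive.
have [g [gE fy gle]] := conjugate_real R r (even_convex_ge0 r r_convex r_even) r_super.
have psiP (b d : R) : (perspective (fun t : R^o => (r t)%:E) (`|x|%R, b) <= d%:E)%E
    <-> dual_cone g (`|x|, b, d).
  (* [phi] is itself radial on the Hilbert space of reals, so the radial description covers its
     perspective. *)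
  have -> : (fun t : R^o => (r t)%:E) = (fun t : R^o => (r `|t|)%:E).
    by apply/funext => t; rewrite (even_normr r r_even).
  have := (perspective_radial_le r r_super r_convex g fy gle (`|x| : R^o) b d).
  by rewrite normr_id.
move=> f P psi case1 case2 case3 c solution.
rewrite {}/case1 {}/case2 {}/case3 {}/solution {}/c !gE.
split.
- by move/psiP; exact: proj_epi_max.
- move=> [_ d0]; rewrite -EFinM -EFinB lee_fin.
  exact: proj_epi_polar.
- move=> [+ + x0]; rewrite -EFinM -EFinB lte_fin /P x0 => nC ed.
  apply: (proj_epi_axis r) => // C0; move: nC; rewrite ltNge => /negP; apply.
  by apply/psiP; rewrite x0 normr0.
move=> n1 n2 n3.
have nC : ~ dual_cone g (`|x|, Num.max eta 0, delta) by move=> /psiP.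
have dpsi : (delta%:E < psi)%E by rewrite ltNge; apply/negP.
have g0 := conjugate0 r g r_convex r_even fy gle.
have dc0 b : 0 < b -> dual_cone g (`|x|, b, delta) <-> b * r (`|x| / b) <= delta.
  by move=> b0; exact: dual_cone_pos.
(* If [x = 0], failure of the third case means [eta <= delta * g 0]; then [delta < 0] falls under
   the second case, and [delta >= 0] puts the point in the cone, which is the first. *)
have x0 : x != 0.
  apply/eqP => x0; move: nC n2 n3 dc0; rewrite x0 normr0 => nC n2 n3 dc0.
  have ed : eta - delta * g 0 <= 0.
    by rewrite leNgt; apply/negP => ed; apply: n3; split=> //; rewrite -EFinM -EFinB lte_fin.
  have [d0|d0] := ltP delta 0.
    by apply: n2; split=> //; rewrite mul0r -EFinM -EFinB lee_fin.
  have [e0|e0] := leP eta 0; move: nC.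
    by rewrite max_r//; apply; split=> //= u; rewrite !mulr0 subr0.
  rewrite max_l ?ltW// => /(dc0 _ e0)/negP; rewrite mul0r -ltNge.
  by move: ed; rewrite g0; nra.
have nx0 : 0 < `|x| by rewrite normr_gt0.
have he : 0 < eta -> delta < eta * r (`|x| / eta).
  by move=> e0; rewrite ltNge; apply/negP => /(dc0 _ e0); move: nC; rewrite max_l// ltW.
have hd : delta < 0 -> 0 < eta - delta * g (`|x| / - delta).
  by move=> d0; rewrite ltNge; apply/negP => ed; apply: n2.
have solE (nu mu s u : R) : 0 < nu -> 0 < mu -> subgradient r s u ->
    `|x| = nu * s + mu * u ->
  ((mu + delta)%:E = nu%:E * (r (prox (fun xi : R^o => (mu / nu)%:E * (r xi)%:E)%E (`|x| / nu)%R))%:E)%E /\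
  ((nu - eta)%:E = mu%:E * (g (prox (fun xi : R^o => (nu / mu)%:E * (g xi)%:E)%E (`|x| / mu)%R))%:E)%E
  <-> eta = nu - mu * g u /\ delta = nu * r s - mu.
  move=> nu0 mu0 us nx.
  have [] := kkt_prox r g fy gle nu mu s u nu0 mu0 us.
  rewrite -nx => -> ->; rewrite -!EFinM.
  split=> -[]; first by move=> [h1] [h2]; split; lra.
  by move=> -> ->; split; congr EFin; ring.
have projE (nu mu s u : R) : 0 < nu -> 0 < mu -> subgradient r s u ->
    `|x| = nu * s + mu * u -> eta = nu - mu * g u -> delta = nu * r s - mu ->
    P (x, eta, delta) = ((s * nu / `|x|) *: x, nu, delta + mu).
  move=> nu0 mu0 us nx -> ->; rewrite subrK.
  exact: (proj_epi_kkt r).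
have [nu [mu [s [u [nu0 mu0 us nx [eE dE]]]]]] :=
  kkt_exists r g r_convex fy gle _ _ _ nx0 he hd.
exists nu, mu; split.
- have [_ /(_ (conj eE dE))[]] := solE nu mu s u nu0 mu0 us nx; by split.
- move=> nu' mu' [nu'0 mu'0 h1 h2].
  (* Any solution arises from a decomposition of [|x|], so it gives the projection too: [nu'] and
     [delta + mu'] are coordinates of one and the same point. *)
  have [s' [u' [us' nx']]] := kkt_of_ratio r g r_convex r_even fy gle nu' mu' `|x| nu'0 mu'0.
  have [/(_ (conj h1 h2))[eE' dE'] _] := solE nu' mu' s' u' nu'0 mu'0 us' nx'.
  have := projE nu mu s u nu0 mu0 us nx eE dE.
  rewrite (projE nu' mu' s' u' nu'0 mu'0 us' nx' eE' dE') => -[_ -> /addrI ->].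
  by [].
rewrite (projE nu mu s u)//.
by have [] := kkt_prox r g fy gle nu mu s u nu0 mu0 us; rewrite -nx => ->.
Qed.
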